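(* There is an absolute constant $c>0$ such that the following holds. Let $\beta^*\in\mathbb R$, $\mathbf X\in\mathbb R^n$ with i.i.d. $N(0,1)$ entries, and $\eta\in\mathbb R^n$ deterministic with $|\{i:|\eta_i|\le1\}|\ge\alpha n$ for some $\alpha\in(0,1]$; let $\mathbf y=\mathbf X\beta^*+\eta$. Let $\hat\beta$ be the output of the Univariate Median Algorithm on $(\mathbf y,\mathbf X)$. Then for any $0<\tau\le\alpha^2n$, \[|\beta^*-\hat\beta|^2\le\frac{\tau}{\alpha^2n}\] with probability at least $1-2\exp(-c\tau)$.
   Context: Univariate Median Algorithm on input $(y,X)\in\mathbb R^n\times\mathbb R^n$: sample independent $w_i\sim N(0,1)$ and Rademacher signs $\sigma_i$ ($i\in[n]$), independent of everything else, and set $y'_i=\sigma_iy_i+w_i$, $X'_i=\sigma_iX_i$. Let $M=\{i:|X'_i|\ge1/2\}$ and output the median of $\{y'_i/X'_i:i\in M\}$ (the $\lceil|M|/2\rceil$-th smallest value). *)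

(* Defs.v *)
From HB Require Import structures.
From mathcomp Require Import all_boot all_order all_algebra.
From mathcomp Require Import all_classical all_reals all_analysis.
Set Implicit Arguments. Unset Strict Implicit. Unset Printing Implicit Defensive.
Import Order.TTheory GRing.Theory Num.Theory.
Local Open Scope classical_set_scope.
Local Open Scope ring_scope.


(* Univariate Median Algorithm, given the sampled signs s_i (in {1,-1}) and
   Gaussian noise w_i:  y'_i = s_i y_i + w_i,  X'_i = s_i X_i,
   M = {i : |X'_i| >= 1/2}, output the ceil(|M|/2)-th smallest value of
   {y'_i / X'_i : i in M} (with multiplicity).  If M is empty we output 0
   (the paper leaves this case unspecified). *)
Definition median_values (R : realType) (n : nat) (y X s w : 'I_n -> R) : seq R :=
  [seq (s i * y i + w i) / (s i * X i) | i <- enum 'I_n & 2^-1 <= `|s i * X i|].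

Definition univariate_median (R : realType) (n : nat) (y X s w : 'I_n -> R) : R :=
  let vs := sort <=%R (median_values y X s w) in
  nth 0 vs (uphalf (size vs)).-1.

Definition mutually_independent3 (R : realType) d (T : measurableType d) (P : probability T R)
    (n : nat) (X w s : 'I_n -> T -> R) : Prop :=
  forall A B C : 'I_n -> set R,
    (forall i, measurable (A i)) -> (forall i, measurable (B i)) ->
    (forall i, measurable (C i)) ->
    P (\bigcap_(i in [set: 'I_n])
         (X i @^-1` A i `&` w i @^-1` B i `&` s i @^-1` C i)) =
    (\prod_(i < n) (P (X i @^-1` A i) * P (w i @^-1` B i) * P (s i @^-1` C i)))%E.

Definition std_normal_rv (R : realType) d (T : measurableType d) (P : probability T R)
    (Z : T -> R) : Prop :=
  forall A : set R, measurable A -> P (Z @^-1` A) = normal_prob 0 1 A.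

Definition rademacher_rv (R : realType) d (T : measurableType d) (P : probability T R)
    (Z : T -> R) : Prop :=
  P (Z @^-1` [set 1]) = (2^-1)%:E /\ P (Z @^-1` [set -1]) = (2^-1)%:E.

(* Main.v *)
(** Dividing by X'_i on M turns the i-th sample into beta + u_i with
    u_i = (s_i eta_i + w_i) / (s_i X_i), so the output exceeds beta + eps only if
    at most half of the samples in M have u_i <= eps.  Replacing X_i by - X_i
    preserves the law of (X_i, w_i, s_i) and negates u_i; hence
    P(M, u_i <= eps) - P(M, u_i > eps) = P(M, |u_i| <= eps), which is always
    nonnegative and is at least a constant times eps when |eta_i| <= 1, because
    s_i eta_i + w_i has a density bounded below near 0.  The votes
    "u_i <= eps" against "u_i > eps" are independent with total mean at least
    a constant times alpha eps n, and a Chernoff bound with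
    eps^2 = tau / (alpha^2 n) gives the upper tail.  The lower tail is the upper
    tail for - X. *)

Require Import Defs.
From HB Require Import structures.
From mathcomp Require Import all_boot all_order all_algebra.
From mathcomp Require Import all_classical all_reals all_analysis.
From mathcomp Require Import measurable_realfun ring lra zify.
Import Order.TTheory GRing.Theory Num.Theory.
Local Open Scope classical_set_scope.
Local Open Scope ring_scope.

(** * Measures determined by boxes, and extension of independence *)

(** Rectangles are stable under intersection, generate the product sigma-algebra and include the
    whole space, whose finite measure makes the constant cover [setT] admissible in the uniqueness
    theorem. *)
Lemma measure_eq_rect2 {R : realType} {d1 d2} {T1 : measurableType d1}
    {T2 : measurableType d2} (m1 m2 : {measure set (T1 * T2) -> \bar R}) :
  (m1 setT < +oo)%E ->
  (forall A B, measurable A -> measurable B -> m1 (A `*` B) = m2 (A `*` B)) ->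
  forall E, measurable E -> m1 E = m2 E.
Proof.
move=> m1fin m12 E mE.
apply: (measure_unique [set A `*` B | A in measurable & B in measurable]
          (fun=> setT)) => //.
- exact: measurable_prod_measurableType.
- move=> _ _ [A mA [B mB <-]] [A' mA' [B' mB' <-]].
  exists (A `&` A'); first exact: measurableI.
  by exists (B `&` B'); [exact: measurableI|rewrite setXI].
- by move=> _; exists setT => //; exists setT => //; rewrite setXTT.
- by rewrite bigcup_const //; exists 0%N.
- by move=> _ [A mA [B mB <-]]; exact: m12.
Qed.

(** Two uses of the two-factor case: for fixed [C], the map [F] to [m (F * C)] is a finite measure
    on the first two factors, realised by restricting to the cylinder over [C] and pushing forward
    along [fst]. *)
Lemma measure_eq_rect3 {R : realType} {d1 d2 d3} {T1 : measurableType d1}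
    {T2 : measurableType d2} {T3 : measurableType d3}
    (m1 m2 : {measure set (T1 * T2 * T3) -> \bar R}) :
  (m1 setT < +oo)%E ->
  (forall A B C, measurable A -> measurable B -> measurable C ->
     m1 (A `*` B `*` C) = m2 (A `*` B `*` C)) ->
  forall E, measurable E -> m1 E = m2 E.
Proof.
move=> m1fin m12; apply: measure_eq_rect2 => // E C mE mC.
have mTC : measurable ([set: T1 * T2] `*` C) by exact: measurableX.
have mfst3 : measurable_fun setT (fst : T1 * T2 * T3 -> T1 * T2).
  exact: measurable_fst.
have restrE (m : {measure set (T1 * T2 * T3) -> \bar R}) (F : set (T1 * T2)) :
    pushforward (mrestr m mTC) fst F = m (F `*` C).
  rewrite /pushforward /mrestr; congr (m _); apply/seteqP.
  by split => -[[x y] z] /=; tauto.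
rewrite -!restrE; apply: (measure_eq_rect2 (pushforward (mrestr m1 mTC) fst)
  (pushforward (mrestr m2 mTC) fst)) => //.
  rewrite /= restrE; apply: le_lt_trans m1fin.
  by apply: le_measure; rewrite ?inE //; exact: measurableX.
by move=> A B mA mB; rewrite /= !restrE; exact: m12.
Qed.

(* The general events are substituted for generators one index at a time: as a
   function of the k-th event both sides are finite measures. *)
Lemma independence_extension {R : realType} {d d'} {T : measurableType d}
    {U : measurableType d'} (P : probability T R) (n : nat) (Y : 'I_n -> T -> U)
    (G : set (set U)) :
  (forall i, measurable_fun setT (Y i)) ->
  G `<=` measurable ->
  (forall m1 m2 : {measure set U -> \bar R}, (m1 setT < +oo)%E ->
     (forall A, G A -> m1 A = m2 A) -> forall A, measurable A -> m1 A = m2 A) ->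
  (forall E : 'I_n -> set U, (forall i, G (E i)) ->
     P (\bigcap_(i in setT) (Y i @^-1` E i)) = (\prod_(i < n) P (Y i @^-1` E i))%E) ->
  forall E : 'I_n -> set U, (forall i, measurable (E i)) ->
     P (\bigcap_(i in setT) (Y i @^-1` E i)) = (\prod_(i < n) P (Y i @^-1` E i))%E.
Proof.
move=> mY Gm Gdet PG E0 mE0.
have mYE i F : measurable F -> measurable (Y i @^-1` F).
  by move=> mF; rewrite -[X in measurable X]setTI; exact: mY.
suff main k (E : 'I_n -> set U) : (forall i, measurable (E i)) ->
    (forall i : 'I_n, (k <= i)%N -> G (E i)) ->
    P (\bigcap_(i in setT) (Y i @^-1` E i)) = (\prod_(i < n) P (Y i @^-1` E i))%E.
  by apply: (main n) => // i; rewrite leqNgt ltn_ord.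
elim: k E => [|k IH] E mE GE; first by apply: PG => i; exact: GE.
have [kn|nk] := ltnP k n; last first.
  by apply: IH => // i /(leq_trans nk); rewrite leqNgt ltn_ord.
pose i0 := Ordinal kn.
pose F := \bigcap_(i in [set i | i != i0]) (Y i @^-1` E i).
have mF : measurable F.
  by apply: fin_bigcap_measurable => [|i _]; [exact: finite_finset|exact: mYE].
pose r := (\prod_(i < n | i != i0) P (Y i @^-1` E i))%E.
have r_fin : r \is a fin_num.
  by apply/prode_fin_num => i _; apply: fin_num_measure; exact: mYE.
have r0 : (0 <= r)%E by apply: prode_ge0.
have r0' : 0 <= fine r by exact: fine_ge0.
pose rn := NngNum r0'.
have splitF (A : set U) :
  \bigcap_(i in setT) (Y i @^-1` (if i == i0 then A else E i)) =
  Y i0 @^-1` A `&` F.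
  apply/seteqP; split => [t H|t [HA HF] i _] /=.
    split; first by have := H i0 I; rewrite /= eqxx.
    by move=> i /= ne; have := H i I; rewrite /= (negbTE ne).
  by case: eqVneq => [->//|ne]; exact: HF.
have prodF (A : set U) :
  (\prod_(i < n) P (Y i @^-1` (if i == i0 then A else E i)) =
   P (Y i0 @^-1` A) * r)%E.
  rewrite (bigD1 i0) //= eqxx; congr (_ * _)%E.
  by apply: eq_bigr => i /negbTE ->.
have Eif : E = fun i => if i == i0 then E i0 else E i.
  by apply/funext => i; case: eqVneq => // ->.
rewrite Eif splitF prodF.
rewrite muleC -[in RHS](fineK r_fin).
(* The measures compared are [A] to [P (Y i0 in A, F)] and [A] to [r * P (Y i0 in A)]. On a
   generator [A] they agree by induction, since then only the indices below [k] carry general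
   events. *)
apply: (Gdet (pushforward (mrestr P mF) (Y i0))
             (mscale rn (pushforward P (Y i0)))) => //.
  apply: (le_lt_trans _ (ltry 1)); apply: probability_le1.
  by apply: measurableI => //; exact: mYE.
move=> A GA; rewrite /= /mscale /pushforward /mrestr /= fineK// muleC -splitF -prodF.
apply: IH => [i|i ki].
  by case: eqP => // _; exact: Gm.
case: eqVneq => // ne; apply: GE; rewrite ltn_neqAle ki andbT.
by apply: contra ne => /eqP e; apply/eqP/val_inj.
Qed.

(** There are finitely many outcome vectors [f], so any event about the whole vector is a finite
    union over them. This serves both measurability and the computation of probabilities. *)
Lemma preimage_ffunE {T : Type} {K : finType} (n : nat) (D : 'I_n -> T -> K)
    (phi : pred {ffun 'I_n -> K}) :
  [set t | phi [ffun i => D i t]] =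
  \bigcup_(f in [set f | phi f]) \bigcap_(i in setT) (D i @^-1` [set f i]).
Proof.
apply/seteqP; split=> [t pt|t [f pf Hf]] /=.
  by exists [ffun i => D i t] => // i _ /=; rewrite ffunE.
suff -> : [ffun i => D i t] = f by [].
by apply/ffunP => i; rewrite ffunE; exact: Hf.
Qed.

Lemma measurable_preimage_ffun {d} {T : measurableType d} {K : finType} (n : nat)
    (D : 'I_n -> T -> K) (phi : pred {ffun 'I_n -> K}) :
  (forall i k, measurable (D i @^-1` [set k])) ->
  measurable [set t | phi [ffun i => D i t]].
Proof.
move=> mD; rewrite preimage_ffunE.
apply: fin_bigcup_measurable => [|f _]; first exact: finite_finset.
by apply: fin_bigcap_measurable => [|i _]; [exact: finite_finset|exact: mD].
Qed.

(** * Exponential tail bound *)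

(** Multiply [1 - x <= expR (- x)] by the quadratic: [(1 + x + 2 x^2) (1 - x) = 1 + x^2 (1 - 2 x)],
    which is at least 1 for [x <= 1/2], negative [x] included. *)
Lemma expR_le_quadratic {R : realType} (x : R) :
  x <= 2^-1 -> expR x <= 1 + x + 2 * x ^+ 2.
Proof.
move=> x2.
have e1 : 1 - x <= (expR x)^-1 by rewrite -expRN; exact: expR_ge1Dx.
have q0 : 0 <= 1 + x + 2 * x ^+ 2.
  by have := sqr_ge0 (x + 4^-1); rewrite !expr2; lra.
have prod1 : 1 <= (1 + x + 2 * x ^+ 2) * (1 - x).
  have -> : (1 + x + 2 * x ^+ 2) * (1 - x) = 1 + x ^+ 2 * (1 - 2 * x) by ring.
  by rewrite lerDl mulr_ge0 ?sqr_ge0//; lra.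
have := le_trans prod1 (ler_wpM2l q0 e1).
by rewrite ler_pdivlMr ?expR_gt0// mul1r.
Qed.

Definition vote_score (R : realType) (k : option bool) : R :=
  if k is Some b then (if b then 1 else -1) else 0.
Arguments vote_score : clear implicits.

Lemma sum_vote_score (R : realType) (n : nat) (f : 'I_n -> option bool) :
  \sum_i vote_score R (f i) =
  #|[pred i | f i == Some true]|%:R - #|[pred i | f i == Some false]|%:R.
Proof.
have cardE k : #|[pred i | f i == k]|%:R = \sum_i (f i == k)%:R :> R.
  rewrite -sum1_card natr_sum big_mkcond; apply: eq_bigr => i _.
  by rewrite inE; case: (f i == k).
rewrite !cardE -sumrB; apply: eq_bigr => i _.
by case: (f i) => [[]|] /=; rewrite ?subr0 ?sub0r ?subrr.
Qed.

(** With [p], [q], [r] the probabilities of yes, no and abstention, the left side is the expectation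
    of [expR (- lam * score)]. The quadratic bound gives at most [1 - lam (p - q) + 2 lam^2]. *)
Lemma vote_mgf_le {R : realType} (p q r lam mu : R) :
  0 <= p -> 0 <= q -> p + q + r = 1 -> 0 <= r -> 0 <= lam <= 2^-1 -> mu <= p - q ->
  p * expR (- lam) + q * expR lam + r <= expR (2 * lam ^+ 2 - lam * mu).
Proof.
move=> p0 q0 pqr r0 /andP[l0 l2] mupq.
apply: le_trans (expR_ge1Dx _).
have h1 : p * expR (- lam) <= p * (1 - lam + 2 * lam ^+ 2).
  apply: ler_wpM2l => //.
  by rewrite -[lam ^+ 2]sqrrN; apply: expR_le_quadratic; lra.
have h2 : q * expR lam <= q * (1 + lam + 2 * lam ^+ 2).
  by apply: ler_wpM2l => //; exact: expR_le_quadratic.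
have h3 : lam * mu <= lam * (p - q) by exact: ler_wpM2l.
have h4 : 0 <= r * lam ^+ 2 by rewrite mulr_ge0 ?sqr_ge0.
have h5 : p * lam ^+ 2 + q * lam ^+ 2 + r * lam ^+ 2 = lam ^+ 2.
  by rewrite -!mulrDl pqr mul1r.
lra.
Qed.

(** Chernoff's method, carried out as a finite sum over outcome vectors: on the event the total
    score is at most 0, so the weight [expR (- lam * score)] is at least 1, ties included. *)
Lemma vote_tail_bound {R : realType} {d} {T : measurableType d}
    (P : probability T R) (n : nat) (D : 'I_n -> T -> option bool)
    (mu : 'I_n -> R) (lam : R) :
  (forall i k, measurable (D i @^-1` [set k])) ->
  (forall f : {ffun 'I_n -> option bool},
     P (\bigcap_(i in setT) (D i @^-1` [set f i])) =
     (\prod_(i < n) P (D i @^-1` [set f i]))%E) ->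
  (forall i, mu i <= fine (P (D i @^-1` [set Some true])) -
                     fine (P (D i @^-1` [set Some false]))) ->
  0 <= lam <= 2^-1 ->
  (P [set t | #|[pred i | D i t == Some true]| <= #|[pred i | D i t == Some false]|]%N
   <= (expR (2 * n%:R * lam ^+ 2 - lam * \sum_i mu i))%:E)%E.
Proof.
move=> mD indep hmu hlam.
pose phi (f : {ffun 'I_n -> option bool}) :=
  (#|[pred i | f i == Some true]| <= #|[pred i | f i == Some false]|)%N.
pose p i k := fine (P (D i @^-1` [set k])).
have pE i k : P (D i @^-1` [set k]) = (p i k)%:E.
  by rewrite /p fineK //; apply: fin_num_measure.
have p0 i k : 0 <= p i k by apply: fine_ge0.
have psum i : p i (Some true) + p i (Some false) + p i None = 1.
  have dis k k' : k != k' -> D i @^-1` [set k] `&` D i @^-1` [set k'] = set0.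
    move=> ne; apply/seteqP; split => // t [/= -> e].
    by move: ne; rewrite e eqxx.
  have := @probability_setT _ _ _ P.
  have -> : [set: T] = D i @^-1` [set Some true] `|` D i @^-1` [set Some false]
                       `|` D i @^-1` [set None].
    apply/seteqP; split => // t _ /=.
    by case: (D i t) => [[]|]; tauto.
  have PU (A B : set T) : measurable A -> measurable B -> A `&` B = set0 ->
    (P (A `|` B) = P A + P B)%E by exact: measureU.
  have mDU := measurableU _ _ (mD i (Some true)) (mD i (Some false)).
  rewrite (PU _ _ mDU (mD i None)); last by rewrite setIUl !dis // setU0.
  rewrite (PU _ _ (mD i (Some true)) (mD i (Some false))); last exact: dis.
  by rewrite !pE -!EFinD => -[].
have -> : [set t | #|[pred i | D i t == Some true]| <=
                   #|[pred i | D i t == Some false]|]%N =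
          [set t | phi [ffun i => D i t]].
  apply: eq_set => t; rewrite /phi; congr (is_true (_ <= _)%N);
    by apply: eq_card => i; rewrite !inE ffunE.
have Pphi : P [set t | phi [ffun i => D i t]] =
    (\sum_(f | phi f) P (\bigcap_(i in setT) (D i @^-1` [set f i])))%E.
  rewrite preimage_ffunE measure_fin_bigcup.
  - by rewrite -(bigfs _ (index_enum_uniq _)) // => f _; rewrite mem_index_enum.
  - exact: finite_finset.
  - move=> f g _ _ [t [Hf Hg]]; apply/ffunP => i.
    by rewrite -(Hf i I) -(Hg i I).
  - move=> f _; apply: fin_bigcap_measurable => [|i _]; last exact: mD.
    exact: finite_finset.
rewrite Pphi.
under eq_bigr => f _ do rewrite indep (eq_bigr _ (fun i _ => pE i (f i))) prodEFin.
rewrite sumEFin lee_fin.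
(* Exponentially tilted weights. They increase the product for every [f] in [phi], and the remaining
   [f] only add nonnegative terms. *)
pose z i k := p i k * expR (- lam * vote_score R k).
have z0 i k : 0 <= z i k by rewrite mulr_ge0 ?expR_ge0.
apply: (@le_trans _ _ (\sum_(f : {ffun 'I_n -> option bool}) \prod_(i < n) z i (f i))).
  rewrite [leRHS](bigID phi) /= -[leLHS]addr0; apply: lerD; last first.
    by apply: sumr_ge0 => f _; apply: prodr_ge0 => i _; exact: z0.
  apply: ler_sum => f phif.
  rewrite big_split /= -expR_sum -mulr_sumr sum_vote_score.
  have pp0 : 0 <= \prod_(i < n) p i (f i) by apply: prodr_ge0 => i _; exact: p0.
  apply: ler_peMr => //.
  rewrite -[leLHS]expR0 ler_expR mulNr -mulrN.
  apply: mulr_ge0; first by case/andP: hlam.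
  by rewrite opprB subr_ge0 ler_nat.
(* The sum of products over all outcome vectors is a product of one-vote sums: the moment generating
   function factorises. *)
rewrite -bigA_distr_bigA /=.
have -> : 2 * n%:R * lam ^+ 2 - lam * (\sum_i mu i) =
          \sum_(i < n) (2 * lam ^+ 2 - lam * mu i).
  by rewrite sumrB sumr_const card_ord -mulr_sumr -[_ *+ n]mulr_natr; ring.
rewrite expR_sum; apply: ler_prod => i _; rewrite sumr_ge0 //=.
rewrite (bigD1 None) // (bigD1 (Some true)) // (bigD1 (Some false)) //= big1 ?addr0.
  rewrite /z /= mulr0 expR0 !mulr1 mulrN1 opprK addrC.
  exact: vote_mgf_le.
by case=> [[]|].
Qed.

(** * Gaussian estimates *)

(** The constant is [27 = 3 * 9]: [sqrt (2 pi) <= 3] because [pi < 4], and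
    [expR (x^2 / 2) <= expR (9/8) <= 9]. *)
Lemma normal_pdf_ge {R : realType} (x : R) :
  - (3 / 2) <= x <= 3 / 2 -> 27^-1 <= normal_pdf 0 1 x.
Proof.
move=> /andP[x1 x2]; rewrite normal_pdfE ?oner_eq0 // /normal_peak /normal_fun.
rewrite expr1n mul1r subr0.
have e9 : expR (9 / 8) <= 9 :> R.
  have -> : 9 / 8 = 3 / 8 * 3%:R :> R by field.
  rewrite expRM_natr.
  have h : expR (3 / 8) <= 5 / 3 :> R.
    have := @expR_le_quadratic R (3 / 8); rewrite expr2 => h.
    by apply: le_trans (h _) _; lra.
  apply: (@le_trans _ _ ((5 / 3) ^+ 3)); last by rewrite !exprS expr0; lra.
  by rewrite lerXn2r // nnegrE ?expR_ge0//; lra.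
have pk : 3^-1 <= (Num.sqrt (pi *+ 2))^-1 :> R.
  have pi4 : pi < 4 :> R.
    by have := @pihalf_lt2 R; rewrite ltr_pdivrMr// => h; lra.
  have pi2 : 0 < pi *+ 2 :> R by rewrite mulrn_wgt0 ?pi_gt0.
  rewrite lef_pV2 ?posrE ?sqrtr_gt0//.
  have -> : 3 = Num.sqrt (3 ^+ 2) :> R by rewrite sqrtr_sqr ger0_norm.
  by rewrite ler_wsqrtr // mulr2n expr2; lra.
have ex : 9^-1 <= expR (- x ^+ 2 / (1 *+ 2)) :> R.
  apply: (@le_trans _ _ (expR (- (9 / 8)))).
    by rewrite expRN lef_pV2 ?posrE ?expR_gt0.
  have x94 : 0 <= (x + 3 / 2) * (3 / 2 - x) by apply: mulr_ge0; lra.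
  rewrite ler_expR; lra.
apply: (@le_trans _ _ (3^-1 * 9^-1)); first by lra.
by apply: ler_pM.
Qed.

(** The density is even and Lebesgue measure is invariant under reflection. *)
Lemma normal_probN {R : realType} (A : set R) : measurable A ->
  normal_prob 0 1 (-%R @^-1` A) = normal_prob 0 1 A.
Proof.
move=> mA; rewrite /normal_prob.
have mN : measurable_fun [set: measurableTypeR R] (-%R : measurableTypeR R -> measurableTypeR R).
  exact: oppr_measurable.
have mpdf : measurable_fun A (EFin \o normal_pdf (0 : R) 1).
  by apply/measurable_funTS/measurable_EFinP; exact: measurable_normal_pdf.
transitivity (\int[pushforward lebesgue_measure (-%R : measurableTypeR R -> measurableTypeR R)]_(x in A)
    (EFin \o normal_pdf 0 1) x)%E.
  rewrite (ge0_integral_pushforward mN _ mA mpdf); last first.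
    by move=> x _ /=; rewrite lee_fin normal_pdf_ge0.
  apply: eq_integral => x _ /=; congr (_%:E).
  by rewrite !normal_pdfE ?oner_eq0 // /normal_fun !subr0 sqrrN.
by apply: eq_measure_integral => //= B mB _; exact: lebesgue_measureN.
Qed.

Lemma normal_prob_itv_ge {R : realType} (a b : R) :
  - (3 / 2) <= a -> a <= b -> b <= 3 / 2 ->
  (((b - a) / 27)%:E <= normal_prob 0 1 `[a, b])%E.
Proof.
move=> ha ab hb; rewrite /normal_prob.
apply: (@le_trans _ _ (\int[lebesgue_measure]_(x in `[a, b]) (27^-1)%:E)%E).
  rewrite integral_cst //= lebesgue_measure_itv /= lte_fin.
  case: ltP => h; first by rewrite -EFinB -EFinM lee_fin mulrC.
  by rewrite mule0 lee_fin; lra.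
apply: ge0_le_integral => //.
- by apply/measurable_funTS/measurable_EFinP; exact: measurable_normal_pdf.
- move=> x /=; rewrite in_itv /= => /andP[ax xb].
  by rewrite lee_fin; apply: normal_pdf_ge; rewrite (le_trans ha ax) (le_trans xb hb).
Qed.

(** * Order statistics as vote counts *)

(** Turns an order statistic into a count, which is how the median becomes a majority vote. *)
Lemma nth_sorted_le {disp} {T : orderType disp} (x0 a : T) (s : seq T) (k : nat) :
  sorted <=%O s -> (k < size s)%N ->
  (nth x0 s k <= a)%O = (k < count (fun x => x <= a)%O s)%N.
Proof.
move=> ss ks; apply/idP/idP => [|h]; last exact: nth_count_le.
apply: contraTT; rewrite -leqNgt -ltNge => h.
apply: nth_count_gt => //; rewrite ks andbT.
by move: h; rewrite (count_le_gt a).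
Qed.

Lemma nth_sorted_lt {disp} {T : orderType disp} (x0 a : T) (s : seq T) (k : nat) :
  sorted <=%O s -> (k < size s)%N ->
  (nth x0 s k < a)%O = (k < count (fun x => x < a)%O s)%N.
Proof.
move=> ss ks; apply/idP/idP => [|h]; last exact: nth_count_lt.
apply: contraTT; rewrite -leqNgt -leNgt => h.
apply: nth_count_ge => //; rewrite ks andbT.
by move: h; rewrite (count_lt_ge a).
Qed.

(* [None] is an abstention: the index is not in M. *)
Definition vote {R : realType} (Q : pred R) (yi xi si wi : R) : option bool :=
  if 2^-1 <= `|si * xi| then Some (Q ((si * yi + wi) / (si * xi))) else None.

Lemma count_median_values {R : realType} (n : nat) (y X s w : 'I_n -> R) (Q : pred R) :
  count Q (median_values y X s w) =
  #|[pred i | vote Q (y i) (X i) (s i) (w i) == Some true]|.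
Proof.
rewrite /median_values count_map count_filter -size_filter cardE.
congr size; rewrite -filter_predI /enum_mem; apply: eq_filter => i.
by rewrite /= !inE /vote andbT; case: ifP => _; rewrite ?andbT ?andbF.
Qed.

Lemma size_median_values {R : realType} (n : nat) (y X s w : 'I_n -> R) (Q : pred R) :
  size (median_values y X s w) =
  (#|[pred i | vote Q (y i) (X i) (s i) (w i) == Some true]| +
   #|[pred i | vote Q (y i) (X i) (s i) (w i) == Some false]|)%N.
Proof.
rewrite -(count_predC Q) count_median_values; congr (_ + _)%N.
rewrite count_median_values; apply: eq_card => i; rewrite !inE /vote.
by case: ifP => //; rewrite /=; case: (Q _).
Qed.

(** With [m = yes + no > 0], the zero-based index is [ceil(m/2) - 1], so the condition is
    [ceil(m/2) <= yes], that is [no <= yes]: a tie counts as yes. For [m = 0] the output is the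
    default 0. *)
Lemma univariate_median_le {R : realType} (n : nat) (y X s w : 'I_n -> R) (a : R) :
  let yes := #|[pred i | vote (<= a) (y i) (X i) (s i) (w i) == Some true]| in
  let no := #|[pred i | vote (<= a) (y i) (X i) (s i) (w i) == Some false]| in
  (univariate_median y X s w <= a) =
  if (yes + no == 0)%N then 0 <= a else (no <= yes)%N.
Proof.
move=> yes no; rewrite /univariate_median size_sort.
have sz : size (median_values y X s w) = (yes + no)%N by exact: size_median_values.
rewrite sz; case: eqP => [m0|/eqP m0].
  by rewrite nth_default // size_sort sz m0.
rewrite nth_sorted_le ?sort_sorted ?size_sort ?sz //; last 2 first.
- exact: le_total.
- by rewrite uphalf_half; lia.
rewrite (permP (permEl (perm_sort _ _))) (count_median_values _ _ _ _ _ (<= a)).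
rewrite -/yes uphalf_half; lia.
Qed.

Lemma univariate_median_lt {R : realType} (n : nat) (y X s w : 'I_n -> R) (a : R) :
  let yes := #|[pred i | vote (< a) (y i) (X i) (s i) (w i) == Some true]| in
  let no := #|[pred i | vote (< a) (y i) (X i) (s i) (w i) == Some false]| in
  (univariate_median y X s w < a) =
  if (yes + no == 0)%N then 0 < a else (no <= yes)%N.
Proof.
move=> yes no; rewrite /univariate_median size_sort.
have sz : size (median_values y X s w) = (yes + no)%N by exact: size_median_values.
rewrite sz; case: eqP => [m0|/eqP m0].
  by rewrite nth_default // size_sort sz m0.
rewrite nth_sorted_lt ?sort_sorted ?size_sort ?sz //; last 2 first.
- exact: le_total.
- by rewrite uphalf_half; lia.
rewrite (permP (permEl (perm_sort _ _))) (count_median_values _ _ _ _ _ (< a)).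
rewrite -/yes uphalf_half; lia.
Qed.

(* The vote on u <= eps, u = (s eta + w) / (s x), with the division cleared by
   multiplying through by (s x)^2. *)
Definition shifted_vote {R : realType} (eps eta x w s : R) : option bool :=
  if 2^-1 <= `|s * x| then
    Some ((s * eta + w) * (s * x) <= eps * (s * x) ^+ 2)
  else None.

(** On M the divisor is nonzero and [(s y + w) / (s x) = beta + u], so [beta] cancels. *)
Lemma vote_le_shifted {R : realType} (beta eps eta x w s : R) :
  vote (<= (beta + eps)) (x * beta + eta) x s w = shifted_vote eps eta x w s.
Proof.
rewrite /vote /shifted_vote; case: ifP => // h; congr Some => /=.
have u0 : 0 < `|s * x| by apply: lt_le_trans h; rewrite invr_gt0.
have ne : s * x != 0 by rewrite -normr_gt0.
have u2 : 0 < (s * x) ^+ 2 by rewrite exprn_even_gt0.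
rewrite -(ler_pM2r u2).
have -> : (s * (x * beta + eta) + w) / (s * x) * (s * x) ^+ 2 =
  (s * eta + w) * (s * x) + beta * (s * x) ^+ 2.
  by rewrite expr2 mulrA divfK//; ring.
by apply/idP/idP; lra.
Qed.

(** The condition is [u < - eps]. Passing to [- x] negates [u], so it reads [u > eps] for the
    reflected sample: the negated shifted vote, with the same abstentions. *)
Lemma vote_lt_shifted {R : realType} (beta eps eta x w s : R) :
  vote (< (beta - eps)) (x * beta + eta) x s w =
  omap negb (shifted_vote eps eta (- x) w s).
Proof.
rewrite /vote /shifted_vote mulrN normrN; case: ifP => // h; congr Some => /=.
have u0 : 0 < `|s * x| by apply: lt_le_trans h; rewrite invr_gt0.
have ne : s * x != 0 by rewrite -normr_gt0.
have u2 : 0 < (s * x) ^+ 2 by rewrite exprn_even_gt0.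
rewrite -ltNge -(ltr_pM2r u2) sqrrN.
have -> : (s * (x * beta + eta) + w) / (s * x) * (s * x) ^+ 2 =
  (s * eta + w) * (s * x) + beta * (s * x) ^+ 2.
  by rewrite expr2 mulrA divfK//; ring.
by apply/idP/idP; lra.
Qed.

Lemma measurable_shifted_vote {R : realType} (eps eta : R) (k : option bool) :
  measurable [set p : R * R * R | shifted_vote eps eta p.1.1 p.1.2 p.2 = k].
Proof.
pose sx (p : R * R * R) := p.2 * p.1.1.
have msx : measurable_fun setT sx.
  by apply: measurable_funM => //; apply: measurableT_comp.
have mM : measurable [set p : R * R * R | 2^-1 <= `|sx p|].
  rewrite -[X in measurable X]setTI.
  apply: (measurable_fun_ler (measurable_cst _) _ measurableT (Y := [set true])) => //.
  exact: measurableT_comp.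
have mQ : measurable [set p : R * R * R | (p.2 * eta + p.1.2) * sx p <= eps * (sx p) ^+ 2].
  rewrite -[X in measurable X]setTI.
  have mf : measurable_fun setT (fun p : R * R * R => (p.2 * eta + p.1.2) * sx p).
    apply: measurable_funM => //; apply: measurable_funD.
      exact: measurable_funM.
    exact: measurableT_comp.
  have mg : measurable_fun setT (fun p : R * R * R => eps * (sx p) ^+ 2).
    by apply: measurable_funM => //; exact: measurable_funX.
  exact: (measurable_fun_ler mf mg measurableT (Y := [set true])).
have -> : [set p : R * R * R | shifted_vote eps eta p.1.1 p.1.2 p.2 = k] =
  match k with
  | Some true => [set p | 2^-1 <= `|sx p|] `&`
                 [set p | (p.2 * eta + p.1.2) * sx p <= eps * (sx p) ^+ 2]
  | Some false => [set p | 2^-1 <= `|sx p|] `\`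
                 [set p | (p.2 * eta + p.1.2) * sx p <= eps * (sx p) ^+ 2]
  | None => ~` [set p | 2^-1 <= `|sx p|]
  end.
  rewrite /shifted_vote /sx; case: k => [[]|]; apply/seteqP; split => p /=;
    case: (2^-1 <= _); case: (_ <= eps * _); intuition congruence.
case: k => [[]|]; [exact: measurableI|exact: measurableD|exact: measurableC].
Qed.

Lemma measurable_shifted_vote_preimage {R : realType} {d} {T : measurableType d}
    (x w s : T -> R) (eps eta : R) (k : option bool) :
  measurable_fun setT x -> measurable_fun setT w -> measurable_fun setT s ->
  measurable ((fun t => shifted_vote eps eta (x t) (w t) (s t)) @^-1` [set k]).
Proof.
move=> mx mw ms; rewrite -[X in measurable X]setTI.
have mY : measurable_fun setT (fun t => (x t, w t, s t)).
  by apply: measurable_fun_pair => //; exact: measurable_fun_pair.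
exact: (mY measurableT _ (measurable_shifted_vote eps eta k)).
Qed.

(** * Bias of a single vote *)

Lemma shifted_vote_bias {R : realType} {d} {T : measurableType d}
    (P : probability T R) (x w s : T -> R) (eps eta : R) :
  measurable_fun setT x -> measurable_fun setT w -> measurable_fun setT s ->
  (forall A B C : set R, measurable A -> measurable B -> measurable C ->
    P (x @^-1` A `&` w @^-1` B `&` s @^-1` C) =
    (P (x @^-1` A) * P (w @^-1` B) * P (s @^-1` C))%E) ->
  std_normal_rv P x -> std_normal_rv P w -> rademacher_rv P s ->
  0 < eps <= 1 ->
  (if `|eta| <= 1 then eps / 729 else 0) <=
  fine (P [set t | shifted_vote eps eta (x t) (w t) (s t) = Some true]) -
  fine (P [set t | shifted_vote eps eta (x t) (w t) (s t) = Some false]).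
Proof.
move=> mx mw ms ind nx nw [s1 sN1] /andP[eps0 eps1].
pose Y t := (x t, w t, s t).
pose Y' t := (- x t, w t, s t).
have mY : measurable_fun setT Y.
  by apply: measurable_fun_pair => //; exact: measurable_fun_pair.
have mY' : measurable_fun setT Y'.
  apply: measurable_fun_pair => //; apply: measurable_fun_pair => //.
  exact: measurableT_comp.
(* Replacing [x] by [- x] preserves the joint law: on boxes this is independence and the symmetry of
   the normal law. *)
have lawE E : measurable E -> P (Y @^-1` E) = P (Y' @^-1` E).
  apply: (measure_eq_rect3 (pushforward P Y) (pushforward P Y')).
    rewrite /= /pushforward; apply: (le_lt_trans _ (ltry 1)).
    by apply: probability_le1; rewrite preimage_setT.
  move=> A B C mA mB mC; rewrite /= /pushforward.
  have mNA : measurable (-%R @^-1` A : set R).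
    by rewrite -[X in measurable X]setTI; exact: oppr_measurable.
  have -> : Y @^-1` (A `*` B `*` C) = x @^-1` A `&` w @^-1` B `&` s @^-1` C by [].
  have -> : Y' @^-1` (A `*` B `*` C) =
    x @^-1` (-%R @^-1` A) `&` w @^-1` B `&` s @^-1` C by [].
  by rewrite !ind // !nx // normal_probN.
pose V k := [set p : R * R * R | shifted_vote eps eta p.1.1 p.1.2 p.2 = k].
have mV k : measurable (V k) by exact: measurable_shifted_vote.
have mYV k : measurable (Y @^-1` V k) by rewrite -[X in measurable X]setTI; exact: mY.
have mYV' k : measurable (Y' @^-1` V k).
  by rewrite -[X in measurable X]setTI; exact: mY'.
rewrite -[X in _ <= fine (P X) - _]/(Y @^-1` V (Some true)).
rewrite -[X in _ <= _ - fine (P X)]/(Y @^-1` V (Some false)).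
rewrite (lawE (V (Some false))) //.
(* A no from the reflected sample means [- u > eps], hence [u <= eps]. *)
have sub : Y' @^-1` V (Some false) `<=` Y @^-1` V (Some true).
  move=> t; rewrite /V /= /shifted_vote mulrN normrN.
  case: ifP => // _ [/negbT]; rewrite -ltNge => h; congr Some.
  have h0 : 0 <= (s t * x t) ^+ 2 by exact: sqr_ge0.
  move: h; rewrite sqrrN => h; nra.
(* [W] is the event that the index lies in M and [|u| <= eps]; its probability is exactly the
   bias. *)
pose W := Y @^-1` V (Some true) `\` Y' @^-1` V (Some false).
have mW : measurable W by exact: measurableD.
have PW : P (Y @^-1` V (Some true)) = (P (Y' @^-1` V (Some false)) + P W)%E.
  rewrite -[in LHS](setDUK sub); apply: measureU => //.
  by rewrite setDE setICA setICr setI0.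
have PWfin : P W \is a fin_num by exact: fin_num_measure.
rewrite PW fineD //; last exact: fin_num_measure.
rewrite addrAC subrr add0r.
case: ifP => eta1; last by apply: fine_ge0.
rewrite -lee_fin fineK //.
have {}eta1 : -1 <= eta <= 1 by rewrite -ler_norml.
(* The normal density is at least 1/27 on [-3/2, 3/2], which contains [I sg] and
   [H]; summing the two signs gives (1/27) (eps/27). *)
pose I sg : set R := `[- sg * eta - eps / 2, - sg * eta + eps / 2]%classic.
pose H : set R := `[2^-1, 3 / 2]%classic.
pose B sg := x @^-1` H `&` w @^-1` (I sg) `&` s @^-1` [set sg].
have mpre (f : T -> R) (A : set R) : measurable_fun setT f -> measurable A ->
    measurable (f @^-1` A).
  by move=> mf mA; rewrite -[X in measurable X]setTI; exact: mf.
have mH : measurable H by exact: measurable_itv.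
have mI sg : measurable (I sg) by exact: measurable_itv.
have mB sg : measurable (B sg).
  apply: measurableI; [apply: measurableI|]; apply: mpre => //.
(* On [B sg], [|s eta + w| <= eps / 2] and [|s x| = x >= 1/2], so [|u| <= eps]. The products [h1],
   [h2], [h3] reduce this to linear arithmetic. *)
have BW sg : sg = 1 \/ sg = -1 -> B sg `<=` W.
  move=> sg2 t [[]]; rewrite /H /I /= !in_itv /= => /andP[x1 x2] /andP[w1 w2] st.
  have nsx : `|s t * x t| = x t.
    by rewrite normrM st; case: sg2 => ->; rewrite ?normrN normr1 mul1r ger0_norm//; lra.
  have x0 : 0 <= x t by lra.
  have h1 : 0 <= (eps / 2 - (sg * eta + w t)) * x t by apply: mulr_ge0; lra.
  have h2 : 0 <= (eps / 2 + (sg * eta + w t)) * x t by apply: mulr_ge0; lra.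
  have h3 : 0 <= eps * (x t * (x t - 2^-1)).
    by apply: mulr_ge0; [exact: ltW|apply: mulr_ge0; lra].
  split; rewrite /V /= /shifted_vote ?mulrN ?normrN nsx x1 st.
    by congr Some; case: sg2 h1 h2 => -> h1 h2; lra.
  by case=> /negbT/negP; apply; case: sg2 h1 h2 => -> h1 h2; lra.
have PB sg : sg = 1 \/ sg = -1 -> P (s @^-1` [set sg]) = (2^-1)%:E ->
    ((eps / 1458)%:E <= P (B sg))%E.
  move=> sg2 Ps; rewrite /B ind // nx // nw // Ps.
  have -> : eps / 1458 = (27^-1 * (eps / 27)) * 2^-1 by field.
  rewrite EFinM; apply: lee_pmul => //.
  - by rewrite lee_fin !mulr_ge0 ?invr_ge0//; lra.
  - rewrite EFinM; apply: lee_pmul; rewrite ?lee_fin ?invr_ge0 //.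
    + lra.
    + apply: le_trans (@normal_prob_itv_ge R _ _ _ _ _); rewrite ?lee_fin; lra.
    + apply: le_trans (@normal_prob_itv_ge R _ _ _ _ _); rewrite ?lee_fin;
        by case: sg2 => ->; lra.
have B0 : B 1 `&` B (-1) = set0.
  apply/seteqP; split => // t [[_ /= e1] [_ /= e2]].
  by move: e1; rewrite e2 => /eqP; rewrite eqNr oner_eq0.
have PB2 : P (B 1 `|` B (-1)) = (P (B 1%R) + P (B (-1)%R))%E by exact: measureU.
apply: (@le_trans _ _ (P (B 1 `|` B (-1)))).
  rewrite PB2; have -> : eps / 729 = eps / 1458 + eps / 1458 by field.
  by rewrite EFinD; apply: leeD; apply: PB => //; [left|right].
apply: le_measure; rewrite ?inE //; first exact: measurableU.
by rewrite subUset; split; apply: BW; [left|right].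
Qed.

(** * Independence of the votes and the one-sided tail *)

(** The hypothesis on [eta] counts a classical set, whereas big sums run over a boolean
    predicate. *)
Lemma card_mem_set {I : finType} (Q : pred I) : #|[set i | Q i]| = #|Q|.
Proof.
apply: eq_card => i; apply/idP/idP => [/set_mem //|h]; exact/mem_set.
Qed.

(** Put [setT] at every other index, where each factor is 1. *)
Lemma mutually_independent3_single {R : realType} {d} {T : measurableType d}
    (P : probability T R) (n : nat) (X w s : 'I_n -> T -> R) (i : 'I_n) (A B C : set R) :
  mutually_independent3 P X w s ->
  measurable A -> measurable B -> measurable C ->
  P (X i @^-1` A `&` w i @^-1` B `&` s i @^-1` C) =
  (P (X i @^-1` A) * P (w i @^-1` B) * P (s i @^-1` C))%E.
Proof.
move=> ind mA mB mC.
pose at_i (F : set R) j : set R := if j == i then F else setT.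
have mat F j : measurable F -> measurable (at_i F j) by rewrite /at_i; case: ifP.
have := ind (at_i A) (at_i B) (at_i C) (fun j => mat _ j mA) (fun j => mat _ j mB)
  (fun j => mat _ j mC).
rewrite (bigD1 i) //= [X in (_ * X)%E]big1; last first.
  move=> j ne; rewrite /at_i (negbTE ne) !preimage_setT !probability_setT.
  by rewrite !mule1.
rewrite /at_i eqxx mule1 => <-; congr (P _).
apply/seteqP; split => [t H j _ | t /(_ i I)]; last by rewrite /= eqxx.
by rewrite /=; case: eqP => [->//|_].
Qed.

(** A vote is not a box event in [(x, w, s)], so independence is extended from boxes to all
    measurable sets of triples. *)
Lemma mutually_independent3_joint {R : realType} {d} {T : measurableType d}
    (P : probability T R) (n : nat) (X w s : 'I_n -> T -> R) :
  (forall i, measurable_fun setT (X i)) ->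
  (forall i, measurable_fun setT (w i)) ->
  (forall i, measurable_fun setT (s i)) ->
  mutually_independent3 P X w s ->
  forall E : 'I_n -> set (R * R * R), (forall i, measurable (E i)) ->
  P (\bigcap_(i in setT) [set t | E i (X i t, w i t, s i t)]) =
  (\prod_(i < n) P [set t | E i (X i t, w i t, s i t)])%E.
Proof.
move=> mX mw ms ind.
apply: (@independence_extension R _ _ T (R * R * R)%type P n
  (fun i t => (X i t, w i t, s i t))
  ([set E | exists A B C, [/\ measurable A, measurable B, measurable C &
                                   E = A `*` B `*` C]])).
- by move=> i; apply: measurable_fun_pair => //; exact: measurable_fun_pair.
- move=> _ [A [B [C [mA mB mC ->]]]].
  by apply: measurableX => //; exact: measurableX.
- move=> m1 m2 m1fin m12; apply: measure_eq_rect3 => // A B C mA mB mC.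
  by apply: m12; exists A, B, C.
move=> E /choice[A] /choice[B] /choice[C] H.
have EE i : (fun t => (X i t, w i t, s i t)) @^-1` E i =
    X i @^-1` A i `&` w i @^-1` B i `&` s i @^-1` C i.
  by have [_ _ _ ->] := H i.
under eq_bigcapr do rewrite EE.
under eq_bigr do rewrite EE.
rewrite ind; try by move=> i; have [] := H i.
by apply: eq_bigr => i _; have [] := H i => *; rewrite mutually_independent3_single.
Qed.

(** The total bias is at least [eps alpha n / 729]. With [lam = eps alpha / (4 * 729)] the Chernoff
    exponent becomes [(1/8 - 1/4) eps^2 alpha^2 n / 729^2]. *)
Lemma shifted_vote_tail {R : realType} {d} {T : measurableType d}
    (P : probability T R) (n : nat) (X w s : 'I_n -> T -> R)
    (alpha eps : R) (eta : 'I_n -> R) :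
  0 < alpha <= 1 ->
  alpha * n%:R <= #|[set i : 'I_n | `|eta i| <= 1]|%:R ->
  (forall i, measurable_fun setT (X i)) ->
  (forall i, measurable_fun setT (w i)) ->
  (forall i, measurable_fun setT (s i)) ->
  mutually_independent3 P X w s ->
  (forall i, std_normal_rv P (X i)) ->
  (forall i, std_normal_rv P (w i)) ->
  (forall i, rademacher_rv P (s i)) ->
  0 < eps <= 1 ->
  (P [set t |
      #|[pred i | shifted_vote eps (eta i) (X i t) (w i t) (s i t) == Some true]| <=
      #|[pred i | shifted_vote eps (eta i) (X i t) (w i t) (s i t) == Some false]|]%N
   <= (expR (- ((8 * 729 ^+ 2)^-1 * (eps ^+ 2 * (alpha ^+ 2 * n%:R)))))%:E)%E.
Proof.
move=> /andP[a0 a1] card_eta mX mw ms ind nX nw rs /andP[e0 e1].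
pose D i t := shifted_vote eps (eta i) (X i t) (w i t) (s i t).
have mD i k : measurable (D i @^-1` [set k]).
  exact: measurable_shifted_vote_preimage.
pose mu i : R := if `|eta i| <= 1 then eps / 729 else 0.
(* minimises 2 n lam^2 - lam eps alpha n / 729 *)
pose lam : R := eps * alpha / (729 * 4).
have lam_itv : 0 <= lam <= 2^-1.
  have h0 : 0 <= eps * alpha by rewrite mulr_ge0 // ltW.
  have h1 : eps * alpha <= 1 by rewrite mulr_ile1 // ltW.
  by rewrite /lam; lra.
have indD (f : {ffun 'I_n -> option bool}) :
    P (\bigcap_(i in setT) (D i @^-1` [set f i])) =
    (\prod_(i < n) P (D i @^-1` [set f i]))%E.
  exact: (mutually_independent3_joint P n X w s mX mw ms ind
    (fun i => [set p | shifted_vote eps (eta i) p.1.1 p.1.2 p.2 = f i])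
    (fun i => measurable_shifted_vote eps (eta i) (f i))).
have hmu i : mu i <= fine (P (D i @^-1` [set Some true])) -
                     fine (P (D i @^-1` [set Some false])).
  apply: shifted_vote_bias => //; last by rewrite e0 e1.
  by move=> A B C; exact: mutually_independent3_single.
apply: le_trans (vote_tail_bound P n D mu lam mD indD hmu lam_itv) _.
rewrite lee_fin ler_expR.
have summu : eps / 729 * (alpha * n%:R) <= \sum_i mu i.
  rewrite /mu -big_mkcond /= sumr_const -[leRHS]mulr_natr.
  have c0 : 0 <= eps / 729 by lra.
  apply: (ler_wpM2l c0).
  by apply: le_trans card_eta _; rewrite card_mem_set.
have := ler_wpM2l (andP lam_itv).1 summu.
rewrite /lam; lra.
Qed.

(** * Absolute constant, reflection of the design, and conclusion *)

(** The constant is rational so that it can be fixed before the real field [R]. *)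
Lemma ratr_inv_mul_sqr (k m : nat) : (0 < k)%N -> (0 < m)%N ->
  exists c : rat, 0 < c /\
  forall R : realType, ratr c = (k%:R * m%:R ^+ 2)^-1 :> R.
Proof.
move=> k0 m0; exists (k%:R * m%:R ^+ 2)^-1; split.
  by rewrite invr_gt0 mulr_gt0 ?exprn_gt0 ?ltr0n.
by move=> R; rewrite fmorphV rmorphM rmorphXn /= !ratr_nat.
Qed.

Lemma mutually_independent3N {R : realType} {d} {T : measurableType d}
    (P : probability T R) (n : nat) (X w s : 'I_n -> T -> R) :
  mutually_independent3 P X w s ->
  mutually_independent3 P (fun i t => - X i t) w s.
Proof.
move=> ind A B C mA mB mC.
apply: (ind (fun i => -%R @^-1` A i)) => // i.
by rewrite -[X in measurable X]setTI; exact: oppr_measurable.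
Qed.

Lemma std_normal_rvN {R : realType} {d} {T : measurableType d}
    (P : probability T R) (Z : T -> R) :
  std_normal_rv P Z -> std_normal_rv P (fun t => - Z t).
Proof.
move=> nZ A mA; rewrite -normal_probN // -nZ //.
by rewrite -[X in measurable X]setTI; exact: oppr_measurable.
Qed.

Theorem mainTheorem13 :
  exists c : rat, 0 < c /\
  forall (R : realType) (n : nat) (alpha betastar : R) (eta : 'I_n -> R),
    0 < alpha <= 1 ->
    alpha * n%:R <= #|[set i : 'I_n | `|eta i| <= 1]|%:R ->
  forall (d : measure_display) (T : measurableType d) (P : probability T R)
         (X w s : 'I_n -> T -> R),
    (forall i, measurable_fun setT (X i)) ->
    (forall i, measurable_fun setT (w i)) ->
    (forall i, measurable_fun setT (s i)) ->
    mutually_independent3 P X w s ->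
    (forall i, std_normal_rv P (X i)) ->
    (forall i, std_normal_rv P (w i)) ->
    (forall i, rademacher_rv P (s i)) ->
  forall tau : R, 0 < tau <= alpha ^+ 2 * n%:R ->
    ((1 - 2 * expR (- (ratr c * tau)))%:E <=
     P [set t | ((betastar -
                 univariate_median (fun i => X i t * betastar + eta i)
                                   (fun i => X i t) (fun i => s i t) (fun i => w i t)) ^+ 2
                <= tau / (alpha ^+ 2 * n%:R))%R])%E.
Proof.
have [c [c0 ratrc]] := ratr_inv_mul_sqr 8 729 isT isT.
exists c; split => // R n alpha beta eta ha card_eta.
move=> d T P X w s mX mw ms ind nX nw rs tau /andP[tau0 tau_le]; rewrite ratrc.
have an0 : 0 < alpha ^+ 2 * n%:R by exact: lt_le_trans tau_le.
(* The admissible error. The assumption [tau <= alpha^2 n] is what gives [eps <= 1], as the bias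
   estimate requires. *)
pose eps := Num.sqrt (tau / (alpha ^+ 2 * n%:R)).
have eps2 : eps ^+ 2 = tau / (alpha ^+ 2 * n%:R).
  by rewrite sqr_sqrtr // divr_ge0 // ltW.
have eps0 : 0 < eps by rewrite sqrtr_gt0 divr_gt0.
have eps1 : eps <= 1.
  by rewrite -(@ler_pXn2r _ 2) ?nnegrE ?(ltW eps0)// eps2 expr1n ler_pdivrMr// mul1r.
have epstau : eps ^+ 2 * (alpha ^+ 2 * n%:R) = tau by rewrite eps2 divfK// gt_eqF.
have eps01 : 0 < eps <= 1 by rewrite eps0 eps1.
have mNX i : measurable_fun setT (fun t => - X i t) by exact: measurableT_comp.
pose med t := univariate_median (fun i => X i t * beta + eta i)
  (fun i => X i t) (fun i => s i t) (fun i => w i t).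
pose D (Z : 'I_n -> T -> R) i t := shifted_vote eps (eta i) (Z i t) (w i t) (s i t).
pose bad Z := [set t | #|[pred i | D Z i t == Some true]| <=
                       #|[pred i | D Z i t == Some false]|]%N.
have mD Z i k : measurable_fun setT (Z i) -> measurable (D Z i @^-1` [set k]).
  by move=> mZ; exact: measurable_shifted_vote_preimage.
(* Events about the median depend only on two vote counts, so their measurability follows without
   that of sorting. *)
have mev (phi : nat -> nat -> bool) Z : (forall i, measurable_fun setT (Z i)) ->
    measurable [set t | phi #|[pred i | D Z i t == Some true]|
                            #|[pred i | D Z i t == Some false]| ].
  move=> mZ.
  have := @measurable_preimage_ffun _ _ _ n (D Z) (fun f =>
    phi #|[pred i | f i == Some true]| #|[pred i | f i == Some false]|)
    (fun i k => mD Z i k (mZ i)).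
  congr measurable; apply: eq_set => t; congr (is_true (phi _ _));
    by apply: eq_card => i; rewrite !inE ffunE.
have medle t : (med t <= beta + eps) =
    let yes := #|[pred i | D X i t == Some true]| in
    let no := #|[pred i | D X i t == Some false]| in
    if (yes + no == 0)%N then 0 <= beta + eps else (no <= yes)%N.
  rewrite /med univariate_median_le /=.
  have E k : #|[pred i | vote (<= (beta + eps)) (X i t * beta + eta i) (X i t)
      (s i t) (w i t) == k]| = #|[pred i | D X i t == k]|.
    by apply: eq_card => i; rewrite !inE vote_le_shifted.
  by rewrite !E.
pose NX i t := - X i t.
(* For the reflected sample yes and no are exchanged, so falling below [beta - eps] again means that
   [Some true] has no strict majority. *)
have medlt t : (med t < beta - eps) =
    let yes := #|[pred i | D NX i t == Some false]| in
    let no := #|[pred i | D NX i t == Some true]| in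
    if (yes + no == 0)%N then 0 < beta - eps else (no <= yes)%N.
  rewrite /med univariate_median_lt /=.
  have E b : #|[pred i | vote (< (beta - eps)) (X i t * beta + eta i) (X i t)
      (s i t) (w i t) == Some b]| = #|[pred i | D NX i t == Some (~~ b)]|.
    apply: eq_card => i; rewrite !inE vote_lt_shifted /D /NX.
    by case: (shifted_vote _ _ _ _ _) => [[]|]; case: b.
  by rewrite !E.
have goodE : [set t | (beta - med t) ^+ 2 <= tau / (alpha ^+ 2 * n%:R)] =
    [set t | med t <= beta + eps] `\` [set t | med t < beta - eps].
  have sqE (z : R) : (z ^+ 2 <= eps ^+ 2) = (`|z| <= eps).
    rewrite -[z ^+ 2](real_normK (num_real z)) ler_pXn2r ?nnegrE //.
    exact: ltW.
  apply/seteqP; split => t /=; rewrite -eps2 sqE ler_norml.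
    by move=> /andP[h1 h2]; split; [lra|apply/negP; rewrite -leNgt; lra].
  by move=> [h1 /negP]; rewrite -leNgt => h2; apply/andP; split; lra.
rewrite goodE.
have mle : measurable [set t | med t <= beta + eps].
  rewrite (eq_set (fun t => congr1 is_true (medle t))) /=.
  exact: (mev (fun yes no => if (yes + no == 0)%N then 0 <= beta + eps
                             else (no <= yes)%N)).
have mlt : measurable [set t | med t < beta - eps].
  rewrite (eq_set (fun t => congr1 is_true (medlt t))) /=.
  exact: (mev (fun no yes => if (yes + no == 0)%N then 0 < beta - eps
                             else (no <= yes)%N)).
have mgood : measurable ([set t | med t <= beta + eps] `\` [set t | med t < beta - eps]).
  exact: measurableD.
have mbad Z : (forall i, measurable_fun setT (Z i)) -> measurable (bad Z).
  exact: (mev (fun yes no => (yes <= no)%N)).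
have Pbad : (P (bad X `|` bad NX) <= (2 * expR (- ((8 * 729 ^+ 2)^-1 * tau)))%:E)%E.
  apply: (@le_trans _ _ (P (bad X) + P (bad NX))%E).
    by apply: measureU2; exact: mbad.
  rewrite mulr_natl mulr2n EFinD -epstau; apply: leeD.
    exact: shifted_vote_tail.
  apply: shifted_vote_tail => //; first exact: mutually_independent3N.
  by move=> i; exact: std_normal_rvN.
(* When M is empty both counts vanish and [0 <= 0] puts the point in a bad event, so the default
   output cannot break the inclusion. *)
have sub : ~` ([set t | med t <= beta + eps] `\` [set t | med t < beta - eps])
    `<=` bad X `|` bad NX.
  move=> t; have [h|] := boolP (med t <= beta + eps).
    move=> ngood; have : med t < beta - eps by apply: contrapT => nlt; exact: ngood.
    rewrite medlt /bad /=; case: ifP => [e _|_ le_no]; right => //.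
    by move: e; rewrite addn_eq0 => /andP[_ /eqP ->].
  rewrite medle /bad /=; case: ifP => [e _|_ nle]; left.
    by move: e; rewrite addn_eq0 => /andP[/eqP -> _].
  by apply: ltnW; rewrite ltnNge.
rewrite -[X in P X]setCK (probability_setC P (measurableC mgood)) EFinB.
apply: leeB => //; apply: le_trans Pbad.
apply: le_measure => //; rewrite inE; first exact: measurableC.
by apply: measurableU; exact: mbad.
Qed.
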